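(* Let $k$ be a field, $n\in\mathbb{N}$, and $q_{ij}\in k$ for $i=1,2$ and $1\le j\le n$. Let $C_n$ be the commutative Hopf algebra with coproduct $\Delta$ determined by the parameters $q_{ij}$. Then for every forest $t\in C_n$, $$\Delta(t)=\sum_{s\subset t}q(s,t)\; s\otimes s^c ,$$ where the sum is over all subforests $s$ of $t$ and $s^c$ is the complementary subforest.
   Context: A rooted tree is a finite partially ordered set with a minimal element (the root) such that $y\neq z$, $y<x$, $z<x$ imply $y<z$ or $z<y$; a forest is a finite disjoint union of rooted trees (possibly empty). Elements are vertices; $|t|$ is the number of vertices of $t$; an edge is a pair $v<w$ with nothing strictly between, and $v$ is its lower vertex. Trees and forests here have edges colored by $\{1,\ldots,n\}$ and are taken up to color-preserving isomorphism. $C_n=\mathsf{Com}[\lambda_n](0)$ is the initial unital commutative $k$-algebra equipped with a linear map $\lambda:C_n^{\otimes n}\to C_n$. Concretely, $C_n$ is the polynomial algebra on the set of rooted trees with edges colored by $\{1,\ldots,n\}$; it has as basis the forests, the product is disjoint union and the unit $1$ is the empty forest. For forests $x_1,\ldots,x_n$, $\lambda(x_1,\ldots,x_n)$ is the tree obtained from the forest $x_1\cdots x_n$ by adding a new root and connecting the root of each tree in $x_j$ to the new root by an edge of color $j$. Define linear maps $\sigma_1,\sigma_2:C_n^{\otimes n}\to C_n$ on forests by $\sigma_i(t_1,\ldots,t_n)=t_1\cdots t_n\cdot\prod_{j}q_{ij}^{|t_j|}$ (with $0^0=1$). The coproduct $\Delta:C_n\to C_n\otimes C_n$ is the unique unital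 algebra homomorphism with $$\Delta\circ\lambda=(\sigma_1\otimes\lambda+\lambda\otimes\sigma_2)\circ\tau\circ\Delta^{\otimes n},$$ where $\tau:(C_n\otimes C_n)^{\otimes n}\to C_n^{\otimes n}\otimes C_n^{\otimes n}$ collects odd-position factors on the left and even-position factors on the right; the counit is $1$ on the empty forest and $0$ on nonempty forests. This makes $C_n$ a commutative Hopf algebra. A subforest $s$ of a forest $t$ is a subset of the vertices of $t$ with the induced order; an edge $w<v$ of $s$ gets the color of that edge of $t$ with lower vertex $w$ lying on the unique path from $v$ down to $w$ in $t$. $s^c$ is the complementary subset, likewise a subforest. For $v\in s$, $p_j(v,s,t)$ is the number of edges of color $j$ on the path in $t$ from $v$ to the root of the connected component of $t$ containing $v$, that have their lower vertex in $s^c=t\setminus s$. Finally $$q(s,t)=\prod_j q_{1j}^{\sum_{v\in s}p_j(v,s,t)}\cdot\prod_j q_{2j}^{\sum_{v\in s^c}p_j(v,s^c,t)} .$$ *)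

(* Defs.v *)
From HB Require Import structures.
From mathcomp Require Import all_boot all_order all_algebra.
From mathcomp Require Import finmap.
From mathcomp Require Export monalg.

Set Implicit Arguments.
Unset Strict Implicit.
Unset Printing Implicit Defensive.

Import GRing.Theory.
Local Open Scope quotient_scope.

Section ForestOrder.
Variable V : finType.
Implicit Types (le : rel V) (A : {set V}) (P : {set {set V}}).

Definition strict le : rel V := fun x y => (x != y) && le x y.

Definition edge le : rel V :=
  fun x y => strict le x y && [forall z, ~~ (strict le x z && strict le z y)].

Definition partial_order le : bool :=
  [&& [forall x, le x x],
      [forall x, forall y, le x y && le y x ==> (x == y)]
    & [forall x, forall y, forall z, le x y && le y z ==> le x z]].

(* A is a rooted tree for the order induced by le. *)
Definition rooted_tree le A : bool :=
  [exists r in A, [forall x in A, le r x]] &&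
  [forall x in A, forall y in A, forall z in A,
     [&& y != z, strict le y x & strict le z x]
       ==> (strict le y z || strict le z y)].

(* V is the disjoint union, as a poset, of rooted trees. *)
Definition forest_order le : bool :=
  partial_order le &&
  [exists P, [&& partition P [set: V],
                 [forall A in P, rooted_tree le A]
               & [forall x, forall y, le x y ==> (pblock P x == pblock P y)]]].

Definition down_chains le :=
  forall x y z, le y x -> le z x -> le y z || le z y.

Lemma partial_orderP le :
  reflect [/\ reflexive le, antisymmetric le & transitive le]
          (partial_order le).
Proof.
apply: (iffP and3P) => [[/forallP r /forallP a /forallP t]|[r a t]]; split.
- exact: r.
- by move=> x y h; move/forallP/(_ y)/implyP/(_ h)/eqP: (a x).
- move=> y x z h1 h2; move/forallP/(_ y)/forallP/(_ z)/implyP: (t x).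
  by apply; rewrite h1 h2.
- by apply/forallP.
- by apply/forallP => x; apply/forallP => y; apply/implyP => /a ->.
- apply/forallP => x; apply/forallP => y; apply/forallP => z.
  by apply/implyP => /andP[h1 h2]; apply: t h1 h2.
Qed.

Lemma has_min le x : reflexive le -> antisymmetric le -> transitive le ->
  exists2 r, le r x & forall y, le y r -> y = r.
Proof.
move=> lr la lt.
have px : le x x by [].
case: (@arg_minnP _ x (fun r => le r x) (fun r => #|[pred y | le y r]|) px).
move=> r rx rmin; exists r => // y yr; apply/eqP/negPn/negP => yNr.
have := rmin y (lt _ _ _ yr rx); rewrite leqNgt => /negP; apply.
apply/proper_card/properP; split.
  by apply/subsetP => z; rewrite !inE => zy; apply: lt zy yr.
exists r; rewrite !inE //; apply: contra yNr => ry.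
by apply/eqP/la; rewrite yr ry.
Qed.

Lemma forest_orderP le :
  reflect [/\ reflexive le, antisymmetric le, transitive le & down_chains le]
          (forest_order le).
Proof.
apply: (iffP andP) => [[/partial_orderP[r a t] /existsP[P]]|[r a t c]].
  case/and3P=> /and3P[/eqP cP tP _] /forall_inP rP /forallP bP; split=> //.
  move=> x y z yx zx; have [yz|yNz] := eqVneq y z; first by rewrite yz r.
  have [ex|yNx] := eqVneq y x; first by rewrite ex zx orbT.
  have [ex|zNx] := eqVneq z x; first by rewrite ex yx.
  have inP u : u \in cover P by rewrite cP.
  have bx : pblock P x \in P by rewrite pblock_mem.
  have b u : le u x -> u \in pblock P x.
    move=> ux; move/forallP/(_ x)/implyP/(_ ux)/eqP: (bP u) => <-.
    by rewrite mem_pblock.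
  case/andP: (rP _ bx) => _ /forall_inP/(_ x (b _ (r x))).
  move=> /forall_inP/(_ y (b _ yx))/forall_inP/(_ z (b _ zx)).
  rewrite /strict yNz yNx zNx yx zx /= (eq_sym z y) yNz /=; exact.
split; first by apply/partial_orderP.
pose R x y := [exists m, le m x && le m y].
have Req : {in [set: V] & &, equivalence_rel R}.
  have Rsym x y : R x y -> R y x.
    by case/existsP=> m /andP[h1 h2]; apply/existsP; exists m; rewrite h1 h2.
  have Rtr x y z : R x y -> R y z -> R x z.
    case/existsP=> m1 /andP[h1 h2]; case/existsP=> m2 /andP[h3 h4].
    case/orP: (c _ _ _ h2 h3) => h; apply/existsP.
      by exists m1; rewrite h1 (t _ _ _ h h4).
    by exists m2; rewrite h4 (t _ _ _ h h1).
  move=> x y z _ _ _; split; first by apply/existsP; exists z; rewrite r.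
  move=> xy; apply/idP/idP => h; last exact: Rtr xy h.
  exact: Rtr (Rsym _ _ xy) h.
have pP := equivalence_partitionP Req.
have := pP => /and3P[/eqP cP tP _].
have inP u : u \in cover (equivalence_partition R [set: V]) by rewrite cP inE.
have blkE x y : (y \in pblock (equivalence_partition R [set: V]) x) = R x y.
  by apply: (pblock_equivalence_partition Req); rewrite inE.
apply/existsP; exists (equivalence_partition R [set: V]); rewrite pP /=.
apply/andP; split; last first.
  apply/forallP => x; apply/forallP => y; apply/implyP => xy.
  rewrite eq_pblock //= blkE.
  by apply/existsP; exists x; rewrite r xy.
apply/forall_inP => A AP; apply/andP; split; last first.
  apply/forall_inP => x _; apply/forall_inP => y _; apply/forall_inP => z _.
  apply/implyP => /and3P[yNz /andP[_ yx] /andP[_ zx]].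
  by rewrite /strict yNz (eq_sym z) yNz; apply: c yx zx.
have /set0Pn[x xA] : A != set0.
  by case/and3P: pP => _ _; apply: contraNneq => <-.
have AE : A = pblock (equivalence_partition R [set: V]) x.
  by rewrite (def_pblock tP AP xA).
have [m mx mmin] := has_min x r a t.
apply/existsP; exists m; rewrite AE blkE; apply/andP; split.
  by apply/existsP; exists m; rewrite mx r.
apply/forall_inP => y; rewrite blkE => /existsP[m' /andP[m'x m'y]].
case/orP: (c _ _ _ mx m'x) => h; first exact: t h m'y.
by rewrite -(mmin _ h).
Qed.

Lemma edge_below le x y : reflexive le -> antisymmetric le -> transitive le ->
  strict le x y -> exists2 w, edge le x w & le w y.
Proof.
move=> r a t xy.
case: (@arg_minnP _ y (fun w => strict le x w && le w y)
   (fun w => #|[pred z | le z w]|)); first by rewrite xy r.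
move=> w /andP[xw wy] wmin; exists w => //; rewrite /edge xw /=.
apply/forallP => z; apply/negP => /andP[xz /andP[zNw zw]].
have := wmin z; rewrite xz (t _ _ _ zw wy) => /(_ isT).
rewrite leqNgt => /negP; apply; apply/proper_card/properP; split.
  by apply/subsetP => u; rewrite !inE => uz; apply: t uz zw.
exists w; rewrite !inE ?r //; apply: contra zNw => wz.
by apply/eqP/a; rewrite zw wz.
Qed.

Lemma eq_strict le le' : le =2 le' -> strict le =2 strict le'.
Proof. by move=> e x y; rewrite /strict e. Qed.

Lemma eq_edge le le' : le =2 le' -> edge le =2 edge le'.
Proof.
move=> e x y; rewrite /edge (eq_strict e); congr (_ && _).
by apply: eq_forallb => z; rewrite !(eq_strict e).
Qed.

Lemma eq_forest_order le le' : le =2 le' ->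
  forest_order le = forest_order le'.
Proof.
move=> e; apply/forest_orderP/forest_orderP => -[r a t c]; split.
- by move=> x; rewrite -e.
- by move=> x y; rewrite -!e; apply: a.
- by move=> x y z; rewrite -!e; apply: t.
- by move=> x y z; rewrite -!e; apply: c.
- by move=> x; rewrite e.
- by move=> x y; rewrite !e; apply: a.
- by move=> x y z; rewrite !e; apply: t.
- by move=> x y z; rewrite !e; apply: c.
Qed.

End ForestOrder.

Lemma edge_bij (V W : finType) (le : rel V) (le' : rel W) (f : V -> W) :
  bijective f -> {mono f : x y / le x y >-> le' x y} ->
  {mono f : x y / edge le x y >-> edge le' x y}.
Proof.
move=> [g fK gK] m x y; rewrite /edge /strict m (can_eq fK); congr (_ && _).
apply/forallP/forallP => h z; first by have := h (f z); rewrite !m !(can_eq fK).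
by have := h (g z); rewrite -!m -!(inj_eq (can_inj fK)) !gK.
Qed.

(* A forest structure on the vertex type V with edges colored by 'I_n: the *)
(* order relation, and the partial function sending (v, w) to the color of *)
(* the edge v < w, which is defined exactly on the edges.                  *)
Section ColoredForest.
Variables (n : nat) (V : finType).

Definition is_cforest (le : rel V) (col : V -> V -> option 'I_n) : bool :=
  forest_order le && [forall x, forall y, isSome (col x y) == edge le x y].

Record cforest := CForest {
  cf_data : {ffun V * V -> bool} * {ffun V * V -> option 'I_n};
  _ : is_cforest (fun x y => cf_data.1 (x, y)) (fun x y => cf_data.2 (x, y)) }.

HB.instance Definition _ := [isSub for cf_data].
HB.instance Definition _ := [Choice of cforest by <:].

Definition fle (t : cforest) : rel V := fun x y => (cf_data t).1 (x, y).
Definition fcol (t : cforest) (x y : V) : option 'I_n := (cf_data t).2 (x, y).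
Definition fedge (t : cforest) : rel V := edge (fle t).

Lemma cforestP (t : cforest) : is_cforest (fle t) (fcol t).
Proof. by case: t. Qed.

Lemma fle_forest (t : cforest) :
  [/\ reflexive (fle t), antisymmetric (fle t), transitive (fle t)
    & down_chains (fle t)].
Proof. by case/andP: (cforestP t) => /forest_orderP. Qed.

Lemma fcol_edge (t : cforest) x y : isSome (fcol t x y) = edge (fle t) x y.
Proof.
by case/andP: (cforestP t) => _ /forallP/(_ x)/forallP/(_ y)/eqP.
Qed.

Variables (le : rel V) (col : V -> V -> option 'I_n).
Hypothesis H : is_cforest le col.

Lemma mk_cforest_subproof :
  is_cforest (fun x y => [ffun p : V * V => le p.1 p.2] (x, y))
             (fun x y => [ffun p : V * V => col p.1 p.2] (x, y)).
Proof.
have e : (fun x y => [ffun p : V * V => le p.1 p.2] (x, y)) =2 le.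
  by move=> x y; rewrite ffunE.
rewrite /is_cforest (eq_forest_order e); case/andP: H => -> /forallP h /=.
apply/forallP => x; apply/forallP => y; rewrite ffunE (eq_edge e).
by move/forallP: (h x).
Qed.

Definition mk_cforest : cforest :=
  @CForest ([ffun p => le p.1 p.2], [ffun p => col p.1 p.2])
           mk_cforest_subproof.

Lemma fle_mk : fle mk_cforest =2 le.
Proof. by move=> x y; rewrite /fle /= ffunE. Qed.

Lemma fcol_mk : fcol mk_cforest =2 col.
Proof. by move=> x y; rewrite /fcol /= ffunE. Qed.

End ColoredForest.

Arguments mk_cforest {n V le col}.

Lemma is_cforestP n (V : finType) (le : rel V) (col : V -> V -> option 'I_n) :
  [/\ reflexive le, antisymmetric le, transitive le & down_chains le] ->
  (forall x y, isSome (col x y) = edge le x y) -> is_cforest le col.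
Proof.
move=> h1 h2; rewrite /is_cforest; apply/andP; split; first exact/forest_orderP.
by apply/forallP => x; apply/forallP => y; rewrite h2.
Qed.

Section Empty.
Variable n : nat.

Lemma empty_subproof :
  is_cforest (fun _ _ : void => true) (fun _ _ => None : option 'I_n).
Proof. by apply: is_cforestP => [|[]]; split; case. Qed.

Definition empty_forest : cforest n void := mk_cforest empty_subproof.
End Empty.

Section DisjointUnion.
Variables (n : nat) (V W : finType) (s : cforest n V) (t : cforest n W).

Definition union_le (a b : V + W) : bool :=
  match a, b with
  | inl x, inl y => fle s x y
  | inr x, inr y => fle t x y
  | _, _ => false
  end.

Definition union_col (a b : V + W) : option 'I_n :=
  match a, b with
  | inl x, inl y => fcol s x y
  | inr x, inr y => fcol t x y
  | _, _ => None
  end.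

Lemma union_subproof : is_cforest union_le union_col.
Proof.
have [r1 a1 t1 c1] := fle_forest s; have [r2 a2 t2 c2] := fle_forest t.
apply: is_cforestP; first split.
- by case=> x /=.
- by case=> x [] y //= h; congr (_ _); [apply: a1|apply: a2].
- by case=> y [] x [] z //=; [apply: t1|apply: t2].
- by case=> x [] y [] z //=; [apply: c1|apply: c2].
case=> x [] y //=; rewrite ?fcol_edge /edge /strict /= ?andbF //=;
  congr (_ && _); apply/forallP/forallP.
- by move=> h [z|z] /=; [exact: h|rewrite ?andbF].
- by move=> h z; exact: (h (inl z)).
- by move=> h [z|z] /=; [rewrite ?andbF|exact: h].
- by move=> h z; exact: (h (inr z)).
Qed.

Definition union_forest : cforest n (V + W)%type := mk_cforest union_subproof.
End DisjointUnion.

Section DisjointUnionFamily.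
Variables (n : nat) (I : finType) (V : I -> finType).
Variable t : forall i, cforest n (V i).

Definition bigunion_le (a b : {i : I & V i}) : bool :=
  (tag a == tag b) && fle (t (tag a)) (tagged a) (tagged_as a b).

Definition bigunion_col (a b : {i : I & V i}) : option 'I_n :=
  if tag a == tag b then fcol (t (tag a)) (tagged a) (tagged_as a b) else None.

Lemma bigunion_leE i (x y : V i) :
  bigunion_le (Tagged V x) (Tagged V y) = fle (t i) x y.
Proof. by rewrite /bigunion_le /= eqxx tagged_asE. Qed.

Lemma bigunion_subproof : is_cforest bigunion_le bigunion_col.
Proof.
have F i := fle_forest (t i).
apply: is_cforestP; first split.
- by case=> i x; rewrite bigunion_leE; case: (F i).
- case=> i x [j y] /andP[/andP[/eqP/= e]]; case: _ / e y => y.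
  rewrite /= tagged_asE bigunion_leE => h1 h2; congr Tagged.
  by case: (F i) => _ a _ _; apply: a; rewrite h1.
- case=> j y [i x] [k z] /andP[/eqP/= e]; case: _ / e y => y.
  rewrite tagged_asE => h1 /andP[/eqP/= e]; case: _ / e z => z.
  rewrite tagged_asE bigunion_leE; case: (F i) => _ _ tr _.
  exact: tr h1.
- case=> i x [j y] [k z] /andP[/eqP/= e]; case: _ / e x => x.
  rewrite tagged_asE => h1 /andP[/eqP/= e].
  case: _ / (esym e) z => z; rewrite tagged_asE => h2.
  by rewrite !bigunion_leE; case: (F j) => _ _ _; apply; [exact: h1|exact: h2].
case=> i x [j y]; rewrite /bigunion_col /=; case: eqP => [e|e]; last first.
  by rewrite /edge /strict /bigunion_le /= (introF eqP e) andbF.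
case: _ / e y => y; rewrite tagged_asE fcol_edge /edge /strict bigunion_leE.
have eqT (u v : V i) : (Tagged V u == Tagged V v) = (u == v).
  by rewrite -tag_eqE /tag_eq /= eqxx tagged_asE.
rewrite eqT; congr (_ && _); apply/forallP/forallP => h; last first.
  by move=> z; have := h (Tagged V z); rewrite !eqT !bigunion_leE.
case=> k z; apply/negP => /andP[/andP[h1 h2] /andP[h3 h4]].
have e : i = k by case/andP: h2 => /eqP.
case: _ / e z h1 h2 h3 h4 => z; rewrite !eqT !bigunion_leE => h1 h2 h3 h4.
by have := h z; rewrite h1 h2 h3 h4.
Qed.

Definition bigunion_forest : cforest n {i : I & V i} :=
  mk_cforest bigunion_subproof.
End DisjointUnionFamily.

(* Adding a new root None to the forest t; the root x of a tree of t is    *)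
(* connected to the new root by an edge of color c x.                      *)
Section AddRoot.
Variables (n : nat) (V : finType) (t : cforest n V) (c : V -> 'I_n).

Definition is_root (x : V) : bool := [forall y, fle t y x ==> (y == x)].

Definition add_root_le (a b : option V) : bool :=
  match a, b with
  | None, _ => true
  | Some x, Some y => fle t x y
  | Some _, None => false
  end.

Definition add_root_col (a b : option V) : option 'I_n :=
  match a, b with
  | None, Some y => if is_root y then Some (c y) else None
  | Some x, Some y => fcol t x y
  | _, None => None
  end.

Lemma add_root_subproof : is_cforest add_root_le add_root_col.
Proof.
have [r a tr ch] := fle_forest t.
apply: is_cforestP; first split.
- by case=> //= x.
- by case=> [x|] [y|] //= h; congr Some; apply: a.
- by case=> [y|] [x|] [z|] //=; apply: tr.
- by case=> [x|] [y|] [z|] //=; apply: ch.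
case=> [x|] [y|] //=.
- rewrite fcol_edge /edge /strict /=; congr (_ && _).
  apply/forallP/forallP => h; last by move=> z; exact: (h (Some z)).
  by case=> [z|] //=; exact: h.
- rewrite (_ : isSome _ = is_root y); last by case: ifP.
  rewrite /edge /strict /=; apply/forallP/forallP => h.
    case=> [z|] //=; have := implyP (h z).
    by have [->|zNy] := eqVneq z y; rewrite ?eqxx //= (inj_eq Some_inj) zNy /=;
       case: (fle t z y) => // /(_ isT).
  move=> z; apply/implyP => zy; apply/negPn/negP => zNy.
  by have := h (Some z); rewrite /= (inj_eq Some_inj) zNy zy.
Qed.

Definition add_root : cforest n (option V) := mk_cforest add_root_subproof.
End AddRoot.

(* The subforest on a set S of vertices, with the induced order; an edge   *)
(* x < y of the subforest has the color of the edge (x, w) of t with       *)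
(* w <= y.                                                                 *)
Section SubForest.
Variables (n : nat) (V : finType) (t : cforest n V) (S : {set V}).

Definition sub_le : rel {x : V | x \in S} := fun x y => fle t (val x) (val y).

Definition sub_col (x y : {x : V | x \in S}) : option 'I_n :=
  if edge sub_le x y then
    [pick j | [exists w, fle t w (val y) && (fcol t (val x) w == Some j)]]
  else None.

Lemma sub_subproof : is_cforest sub_le sub_col.
Proof.
have [r a tr c] := fle_forest t.
apply: is_cforestP; first split.
- by move=> x; apply: r.
- by move=> x y h; apply/val_inj/a.
- by move=> x y z; apply: tr.
- by move=> x y z; apply: c.
move=> x y; rewrite /sub_col; case: ifP => // /andP[/andP[xNy xy] _].
case: pickP => //= no.
have [|w xw wy] := @edge_below _ (fle t) (val x) (val y) r a tr.
  by rewrite /strict (inj_eq val_inj) xNy; exact: xy.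
move: xw; rewrite -fcol_edge; case E : (fcol _ _ _) => [j|] // _.
by have := no j; move/existsP; case; exists w; rewrite wy E eqxx.
Qed.

Definition subforest : cforest n {x : V | x \in S} := mk_cforest sub_subproof.
End SubForest.

Definition cf_iso n (V W : finType) (s : cforest n V) (t : cforest n W) : Prop :=
  exists f : V -> W, [/\ bijective f,
    {mono f : x y / fle s x y >-> fle t x y} &
    {mono f : x y / fcol s x y >-> fcol t x y}].

Definition cf_isob n (V W : finType) (s : cforest n V) (t : cforest n W) : bool :=
  [exists f : {ffun V -> W},
    [&& [exists g : {ffun W -> V},
           [forall x, g (f x) == x] && [forall y, f (g y) == y]],
        [forall x, forall y, fle t (f x) (f y) == fle s x y] &
        [forall x, forall y, fcol t (f x) (f y) == fcol s x y]]].

Lemma cf_isoP n (V W : finType) (s : cforest n V) (t : cforest n W) :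
  reflect (cf_iso s t) (cf_isob s t).
Proof.
apply: (iffP existsP) => [[f /and3P[/existsP[g /andP[/forallP fK /forallP gK]]]]|].
  move=> /forallP h1 /forallP h2; exists f; split.
  - by exists g => x; apply/eqP.
  - by move=> x y; move/forallP/(_ y)/eqP: (h1 x).
  - by move=> x y; move/forallP/(_ y)/eqP: (h2 x).
case=> f [[g fK gK] h1 h2]; exists [ffun x => f x]; apply/and3P; split.
- apply/existsP; exists [ffun x => g x].
  by apply/andP; split; apply/forallP => x; rewrite !ffunE ?fK ?gK.
- by apply/forallP => x; apply/forallP => y; rewrite !ffunE h1.
- by apply/forallP => x; apply/forallP => y; rewrite !ffunE h2.
Qed.

Lemma cf_iso_refl n (V : finType) (s : cforest n V) : cf_iso s s.
Proof. by exists id; split => //; exists id. Qed.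

Lemma cf_iso_sym n (V W : finType) (s : cforest n V) (t : cforest n W) :
  cf_iso s t -> cf_iso t s.
Proof.
case=> f [[g fK gK] h1 h2]; exists g; split; first by exists f.
  by move=> x y; rewrite -h1 !gK.
by move=> x y; rewrite -h2 !gK.
Qed.

Lemma cf_iso_trans n (U V W : finType) (s : cforest n U) (t : cforest n V)
    (u : cforest n W) : cf_iso s t -> cf_iso t u -> cf_iso s u.
Proof.
case=> f [fb f1 f2] [g [gb g1 g2]]; exists (g \o f); split.
- exact: bij_comp.
- by move=> x y /=; rewrite g1.
- by move=> x y /=; rewrite g2.
Qed.

(* Isomorphism classes are represented by structures on the types 'I_m. *)
Section ForestClasses.
Variable n : nat.

Definition code := {m : nat & cforest n 'I_m}.

Definition code_iso : rel code := fun s t => cf_isob (tagged s) (tagged t).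

Lemma code_iso_refl : reflexive code_iso.
Proof. by move=> s; apply/cf_isoP/cf_iso_refl. Qed.

Lemma code_iso_sym : symmetric code_iso.
Proof. by move=> s t; apply/cf_isoP/cf_isoP; apply: cf_iso_sym. Qed.

Lemma code_iso_trans : transitive code_iso.
Proof.
by move=> t s u /cf_isoP h1 /cf_isoP h2; apply/cf_isoP; apply: cf_iso_trans h2.
Qed.

Canonical code_iso_equiv :=
  EquivRel code_iso code_iso_refl code_iso_sym code_iso_trans.

Definition forest := {eq_quot code_iso}%qT.
HB.instance Definition _ := Choice.on forest.
HB.instance Definition _ := EqQuotient.on forest.

Section Relabel.
Variables (V : finType) (t : cforest n V).

Lemma relabel_subproof :
  is_cforest (fun i j : 'I_#|V| => fle t (enum_val i) (enum_val j))
             (fun i j => fcol t (enum_val i) (enum_val j)).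
Proof.
have [r a tr c] := fle_forest t.
apply: is_cforestP; first split.
- by move=> x; apply: r.
- by move=> x y h; apply/enum_val_inj/a.
- by move=> x y z; apply: tr.
- by move=> x y z; apply: c.
by move=> x y; rewrite fcol_edge; apply: edge_bij => //; apply: enum_val_bij.
Qed.

Definition relabel : cforest n 'I_#|V| := mk_cforest relabel_subproof.

Lemma relabel_iso : cf_iso relabel t.
Proof.
exists enum_val; split; first exact: enum_val_bij.
  by move=> x y; rewrite fle_mk.
by move=> x y; rewrite fcol_mk.
Qed.

Definition fclass : forest :=
  \pi_forest (Tagged (fun m => cforest n 'I_m) relabel).
End Relabel.

Definition frepr (x : forest) : cforest n 'I_(tag (repr x)) := tagged (repr x).

Definition fsize (x : forest) : nat := tag (repr x).

Lemma fclass_eq (V W : finType) (s : cforest n V) (t : cforest n W) :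
  (fclass s = fclass t) <-> cf_iso s t.
Proof.
split=> [/eqmodP/cf_isoP /= h|h].
  apply: cf_iso_trans (relabel_iso t).
  exact: cf_iso_trans (cf_iso_sym (relabel_iso s)) h.
apply/eqmodP/cf_isoP => /=.
apply: cf_iso_trans (cf_iso_sym (relabel_iso t)).
exact: cf_iso_trans (relabel_iso s) h.
Qed.

Lemma freprK (x : forest) : fclass (frepr x) = x.
Proof.
rewrite -[RHS]reprK; apply/eqmodP/cf_isoP => /=; exact: relabel_iso.
Qed.

Lemma fclassK (V : finType) (t : cforest n V) : cf_iso (frepr (fclass t)) t.
Proof. by apply/fclass_eq; rewrite freprK. Qed.

Lemma fsize_class (V : finType) (t : cforest n V) : fsize (fclass t) = #|V|.
Proof.
case: (fclassK t) => f [fb _ _].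
by rewrite -(bij_eq_card fb) card_ord.
Qed.

Definition funit : forest := fclass (empty_forest n).
Definition fmul (x y : forest) : forest :=
  fclass (union_forest (frepr x) (frepr y)).

Lemma union_iso (V V' W W' : finType) (s : cforest n V) (s' : cforest n V')
    (t : cforest n W) (t' : cforest n W') :
  cf_iso s s' -> cf_iso t t' -> cf_iso (union_forest s t) (union_forest s' t').
Proof.
case=> f [[f' fK fK'] f1 f2] [g [[g' gK gK'] g1 g2]].
exists (fun a => match a with inl x => inl (f x) | inr y => inr (g y) end).
split.
- exists (fun a => match a with inl x => inl (f' x) | inr y => inr (g' y) end).
    by case=> x; rewrite ?fK ?gK.
  by case=> x; rewrite ?fK' ?gK'.
- by case=> x [] y; rewrite !fle_mk /= ?f1 ?g1.
- by case=> x [] y; rewrite !fcol_mk /= ?f2 ?g2.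
Qed.

Lemma fmul_class (V W : finType) (s : cforest n V) (t : cforest n W) :
  fmul (fclass s) (fclass t) = fclass (union_forest s t).
Proof. by apply/fclass_eq/union_iso; apply: fclassK. Qed.

Lemma fmulC : commutative fmul.
Proof.
move=> x y; apply/fclass_eq.
exists (fun a => match a with inl x => inr x | inr y => inl y end); split.
- by exists (fun a => match a with inl x => inr x | inr y => inl y end); case.
- by case=> a [] b; rewrite !fle_mk.
- by case=> a [] b; rewrite !fcol_mk.
Qed.

Lemma fmul1 : left_id funit fmul.
Proof.
move=> x; rewrite -{1}[x]freprK /funit fmul_class -[RHS]freprK; apply/fclass_eq.
exists (fun a : void + _ => match a with inl v => of_void _ v | inr y => y end).
split.
- by exists inr => // -[[]|].
- by case=> [[]|a] [[]|b]; rewrite !fle_mk.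
- by case=> [[]|a] [[]|b]; rewrite !fcol_mk.
Qed.

Lemma fmulA : associative fmul.
Proof.
move=> x y z; rewrite -[x]freprK -[y]freprK -[z]freprK !fmul_class.
apply/fclass_eq.
exists (fun a => match a with
  | inl u => inl (inl u) | inr (inl u) => inl (inr u) | inr (inr u) => inr u
  end); split.
- by exists (fun a => match a with
  | inl (inl u) => inl u | inl (inr u) => inr (inl u) | inr u => inr (inr u)
  end); [case=> [|[]] | case=> [[]|]].
- by case=> [a|[a|a]] [b|[b|b]]; do !rewrite !fle_mk /=.
- by case=> [a|[a|a]] [b|[b|b]]; do !rewrite !fcol_mk /=.
Qed.

Lemma fmul_unit x y : fmul x y = funit -> x = funit /\ y = funit.
Proof.
have size0 z : fsize z = 0 -> z = funit.
  move=> z0; rewrite -[z]freprK; apply/fclass_eq.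
  have no (i : 'I_(fsize z)) : False by case: i; rewrite z0.
  exists (fun i => match no i with end); split.
  - by exists (fun i : void => match i with end) => [i|[]]; case: (no i).
  - by move=> i; case: (no i).
  - by move=> i; case: (no i).
move/(congr1 fsize); rewrite /fmul /funit !fsize_class card_sum !card_ord.
rewrite card_void => /eqP; rewrite addn_eq0 => /andP[/eqP hx /eqP hy].
by split; apply: size0.
Qed.

HB.instance Definition _ := Choice_isMonomialDef.Build forest
  fmulA fmul1 (fun x => etrans (fmulC x funit) (fmul1 x)) fmul_unit.
HB.instance Definition _ := MonomialDef_isConomialDef.Build forest fmulC.

(* The tree obtained from x_1 ... x_n by adding a new root, the roots of   *)
(* the trees of x_j being connected to the new root by edges of color j.   *)
Definition graft (x : {ffun 'I_n -> forest}) : forest :=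
  fclass (add_root (bigunion_forest (fun j => frepr (x j))) tag).

End ForestClasses.

Section PairMonoid.
Variables K L : conomType.

Definition pair_mul (x y : K * L) : K * L := (mmul x.1 y.1, mmul x.2 y.2).
Definition pair_one : K * L := (mone, mone).

Lemma pair_mulA : associative pair_mul.
Proof. by move=> x y z; rewrite /pair_mul /= !mulmA. Qed.

Lemma pair_mulC : commutative pair_mul.
Proof. by move=> x y; rewrite /pair_mul mulmC (mulmC x.2). Qed.

Lemma pair_mul1 : left_id pair_one pair_mul.
Proof. by case=> x y; rewrite /pair_mul /= !mul1m. Qed.

Lemma pair_mulr1 : right_id pair_one pair_mul.
Proof. by case=> x y; rewrite /pair_mul /= !mulm1. Qed.

Lemma pair_unit x y : pair_mul x y = pair_one -> x = pair_one /\ y = pair_one.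
Proof.
case: x y => [x1 x2] [y1 y2] [/unitm[/= -> ->] /unitm[/= -> ->]].
by split.
Qed.

HB.instance Definition _ := Choice_isMonomialDef.Build (K * L)%type
  pair_mulA pair_mul1 pair_mulr1 pair_unit.
HB.instance Definition _ :=
  MonomialDef_isConomialDef.Build (K * L)%type pair_mulC.
End PairMonoid.

Local Open Scope ring_scope.

(* {malg k[K]} is the free k-module on K; the tensor product of            *)
(* {malg k[K]} and {malg k[L]} is the free module {malg k[K * L]}, and the *)
(* I-fold tensor power of {malg k[K]} is {malg k[{ffun I -> K}]}. When K   *)
(* and L are monoids, the algebra structure of {malg k[K * L]} is the      *)
(* componentwise one.                                                      *)
Section Tensor.
Variable k : fieldType.

Definition lin_ext (K : choiceType) (M : lmodType k) (f : K -> M)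
    (u : {malg k[K]}) : M :=
  \sum_(x <- msupp u) u@_x *: f x.

Lemma lin_extEw (K : choiceType) (M : lmodType k) (f : K -> M) (d : {fset K}) u :
  (msupp u `<=` d)%fset -> lin_ext f u = \sum_(x <- d) u@_x *: f x.
Proof.
move=> le; rewrite /lin_ext (big_fset_incl _ le) //= => x _ /mcoeff_outdom ->.
by rewrite scale0r.
Qed.

Lemma lin_extU (K : choiceType) (M : lmodType k) (f : K -> M) x :
  lin_ext f << x >> = f x.
Proof. by rewrite (lin_extEw _ msuppU_le) big_seq_fset1 mcoeffUU scale1r. Qed.

Lemma lin_ext_linear (K : choiceType) (M : lmodType k) (f : K -> M) :
  linear (lin_ext f).
Proof.
move=> c u v; pose d := (msupp u `|` msupp v)%fset.
have du : (msupp u `<=` d)%fset by apply: fsubsetUl.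
have dv : (msupp v `<=` d)%fset by apply: fsubsetUr.
rewrite !(@lin_extEw _ _ _ d) //; last first.
  apply: fsubset_trans (msuppD_le _ _) _; rewrite fsubUset dv andbT.
  exact: fsubset_trans (msuppZ_le _ _) du.
rewrite scaler_sumr -big_split /=; apply: eq_bigr => x _.
by rewrite mcoeffD mcoeffZ scalerDl scalerA.
Qed.

Definition tens (K L : choiceType) (u : {malg k[K]}) (v : {malg k[L]}) :
    {malg k[(K * L)%type]} :=
  \sum_(x <- msupp u) \sum_(y <- msupp v) << u@_x * v@_y *g (x, y) >>.

Lemma mcoeff_tens (K L : choiceType) (u : {malg k[K]}) (v : {malg k[L]}) x y :
  (tens u v)@_(x, y) = u@_x * v@_y.
Proof.
rewrite /tens raddf_sum /=.
have -> : u@_x = (\sum_(x0 <- msupp u) << u@_x0 *g x0 >>)@_x by rewrite -monalgE.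
rewrite raddf_sum mulr_suml /=; apply: eq_bigr => i _.
have -> : v@_y = (\sum_(x0 <- msupp v) << v@_x0 *g x0 >>)@_y by rewrite -monalgE.
rewrite !raddf_sum mulr_sumr; apply: eq_bigr => j _ /=.
by rewrite !mcoeffU xpair_eqE; case: (i == x); case: (j == y); rewrite ?mulr1n ?mulr0n ?mulr0 ?mul0r.
Qed.

Definition tens_map (K L K' L' : choiceType)
    (f : {malg k[K]} -> {malg k[K']}) (g : {malg k[L]} -> {malg k[L']}) :
    {malg k[(K * L)%type]} -> {malg k[(K' * L')%type]} :=
  lin_ext (fun p => tens (f << p.1 >>) (g << p.2 >>)).

Variable I : finType.

(* The pure tensor of the family u. *)
Definition big_tens (K : choiceType) (u : I -> {malg k[K]}) :
    {malg k[{ffun I -> K}]} :=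
  \sum_(h : {ffun I -> (\bigcup_(i in I) msupp (u i))%fset})
     << \prod_i (u i)@_(val (h i)) *g [ffun i => val (h i)] >>.

Lemma mcoeff_big_tens (K : choiceType) (u : I -> {malg k[K]}) h :
  (big_tens u)@_h = \prod_i (u i)@_(h i).
Proof.
rewrite /big_tens raddf_sum /=.
pose d := (\bigcup_(i in I) msupp (u i))%fset.
have sub i : {subset msupp (u i) <= d}.
  by apply/fsubsetP; apply: bigfcup_sup; rewrite ?mem_index_enum.
case: (boolP [forall i, h i \in d]) => [/forallP hd|].
  pose h' : {ffun I -> d} := [ffun i => [` hd i]%fset].
  have hE : [ffun i => val (h' i)] = h by apply/ffunP=> i; rewrite !ffunE.
  rewrite (bigD1 h') //= [X in _ + X]big1 ?addr0; last first.
    move=> g gh; rewrite mcoeffU; case: eqP => // e; case/eqP: gh.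
    by apply/ffunP => i; apply: val_inj; move/ffunP/(_ i): e; rewrite -hE !ffunE.
  rewrite mcoeffU hE eqxx mulr1n.
  by apply: eq_bigr => i _; rewrite ffunE.
rewrite negb_forall => /existsP[i hi].
rewrite [RHS](bigD1 i) //= [(u i)@_(h i)]mcoeff_outdom ?mul0r; last first.
  by apply: contra hi; apply: sub.
apply: big1 => g _; rewrite mcoeffU; case: eqP => // e; case/negP: hi.
by rewrite -e ffunE; apply: valP.
Qed.

Definition big_tens_map (K L : choiceType)
    (f : {malg k[K]} -> {malg k[L]}) :
    {malg k[{ffun I -> K}]} -> {malg k[{ffun I -> L}]} :=
  lin_ext (fun x : {ffun I -> K} => big_tens (fun i => f << x i >>)).

Definition tau (K L : choiceType) :
    {malg k[{ffun I -> (K * L)%type}]} ->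
    {malg k[({ffun I -> K} * {ffun I -> L})%type]} :=
  lin_ext (fun h : {ffun I -> (K * L)%type} =>
    << ([ffun i => (h i).1], [ffun i => (h i).2]) >>).

End Tensor.

Notation Calg k n := {malg k[forest n]}.
Notation Calg_tens2 k n := {malg k[(forest n * forest n)%type]}.
Notation Calg_tensn k n := {malg k[{ffun 'I_n -> forest n}]}.

Section Coproduct.
Variables (k : fieldType) (n : nat).

Definition lambda : Calg_tensn k n -> Calg k n :=
  lin_ext (fun x : {ffun 'I_n -> forest n} => << graft x >>).

(* q i j is the parameter q_ij, the rows 1 and 2 being the elements ord0   *)
(* and ord_max of 'I_2.                                                    *)
Variable q : 'I_2 -> 'I_n -> k.

Definition sigma (i : 'I_2) : Calg_tensn k n -> Calg k n :=
  lin_ext (fun x : {ffun 'I_n -> forest n} =>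
    (\prod_(j < n) q i j ^+ fsize (x j)) *: \prod_(j < n) << x j >>).

Definition is_coproduct (Delta : {lrmorphism Calg k n -> Calg_tens2 k n}) :=
  forall u : Calg_tensn k n,
    let v := tau (big_tens_map Delta u) in
    Delta (lambda u) =
      tens_map (sigma ord0) lambda v + tens_map lambda (sigma ord_max) v.

Variables (V : finType) (t : cforest n V).

(* p_j(v, S, t): the edges on the path from v to the root of its component *)
(* are the edges whose upper vertex is below or equal to v.                *)
Definition pcount (j : 'I_n) (v : V) (S : {set V}) : nat :=
  #|[set e : V * V | [&& fcol t e.1 e.2 == Some j, fle t e.2 v & e.1 \notin S]]|.

Definition qcoef (S : {set V}) : k :=
  (\prod_(j < n) q ord0 j ^+ (\sum_(v in S) pcount j v S)) *
  (\prod_(j < n) q ord_max j ^+ (\sum_(v in ~: S) pcount j v (~: S))).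

End Coproduct.

(* Main.v *)
From HB Require Import structures.
Require Import Defs.
From mathcomp Require Import all_boot all_order all_algebra.
From mathcomp Require Import finmap monalg.

Set Implicit Arguments.
Unset Strict Implicit.
Unset Printing Implicit Defensive.

Import GRing.Theory.
Local Open Scope ring_scope.

(** The formula is proved by induction, but inside one fixed forest [t]: for
    every up-closed set [B] of vertices,

      Delta(t|B) = sum over S included in B of q(S, B - S) (t|S) (x) (t|B-S),

    where [t|S] is the subforest on [S] and [q(S, C)] counts, below each vertex
    of one of the two sets, the edges of [t] whose lower vertex lies in the other
    set.  Up-closed sets are the vertex sets of the forests met when trees are
    separated and roots are removed, and since they all live in [t], both sides
    of the induction step are sums over subsets of the same finite type.  The
    case where [B] is the whole vertex set is the theorem.

    There are two steps ([splits_coproduct_up_closed]).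
    - If [B] is a disjoint union of up-closed sets [B_i], no vertex of one block
      is comparable with a vertex of another.  Hence subforests are products of
      their blocks ([restr_family]), the coefficients are multiplicative
      ([split_coef_family]), and multiplicativity of [Delta] together with
      distributivity ([bigA_distr_subset]) gives the formula for [B].
    - If [B] has a least element [r], then [t|B] is obtained by grafting the
      [t|B_j], where [B_j] is the set of vertices to which the path from [r]
      starts with an edge of color [j] ([restr_root]).  The defining equation of [Delta]
      yields one sum from each of its two terms.  The term with [sigma_1] gives
      the subsets [S] that omit [r]: then [r] is the lower vertex of an edge of
      color [j] under every vertex of [S] in [B_j], which is the factor
      [q_1j ^ |S_j|].  The term with [sigma_2] gives the subsets that contain [r],
      with the roles of [S] and its complement exchanged. *)

(** * Sums over the subsets of a disjoint union *)

(** Choosing a subset of each block amounts to choosing a subset of the union: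
    the families produced by distributivity are the traces [S :&: B i]. *)
Lemma bigA_distr_subset (R : comPzSemiRingType) (V I : finType)
    (B : I -> {set V}) (F : I -> {set V} -> R) :
  (forall i j x, x \in B i -> x \in B j -> i = j) ->
  \prod_i \sum_(S : {set V} | S \subset B i) F i S =
    \sum_(S : {set V} | S \subset \bigcup_i B i) \prod_i F i (S :&: B i).
Proof.
move=> Bdisj.
rewrite (bigA_distr_big_dep (fun i => [pred S : {set V} | S \subset B i]) F) /=.
rewrite (reindex_onto (fun S : {set V} => [ffun i => S :&: B i])
                      (fun f => \bigcup_i f i)) /=; last first.
  move=> f /familyP fB; apply/ffunP => i; rewrite ffunE; apply/setP => x.
  rewrite !inE; apply/andP/idP => [[/bigcupP[j _ xj] xi]|xi].
    by have /subsetP/(_ x xj) xBj := fB j; rewrite (Bdisj _ _ _ xi xBj).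
  have /subsetP/(_ x xi) xBi := fB i.
  by split=> //; apply/bigcupP; exists i.
apply: eq_big => [S|S _]; last by apply: eq_bigr => i _; rewrite ffunE.
have -> : \bigcup_i [ffun i0 => S :&: B i0] i = S :&: \bigcup_i B i.
  by rewrite big_distrr; apply: eq_bigr => i _; rewrite ffunE.
rewrite (sameP eqP setIidPl) andbC; apply: andb_idr => _.
by apply/familyP => i; rewrite ffunE; apply: subsetIr.
Qed.

Lemma setD_family (V I : finType) (B : I -> {set V}) (S : {set V}) i :
  B i :\: (S :&: B i) = (\bigcup_i B i :\: S) :&: B i.
Proof.
apply/setP => x; rewrite !inE negb_and andb_orl andNb orbF.
rewrite -andbA; congr (_ && _); symmetry; apply: andb_idl => xi.
by apply/bigcupP; exists i.
Qed.

Section Algebra.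
Variable k : fieldType.

HB.instance Definition _ (K : choiceType) (M : lmodType k) (f : K -> M) :=
  GRing.isLinear.Build k {malg k[K]} M _ (lin_ext f) (lin_ext_linear f).

Lemma lin_ext_sum (K : choiceType) (M : lmodType k) (f : K -> M)
    (T : finType) (P : pred T) (c : T -> k) (x : T -> K) :
  lin_ext f (\sum_(i | P i) c i *: << x i >>) = \sum_(i | P i) c i *: f (x i).
Proof.
by rewrite linear_sum; apply: eq_bigr => i _; rewrite linearZ /= lin_extU.
Qed.

Lemma mcoeff_basis (K : choiceType) (x y : K) :
  (<< x >> : {malg k[K]})@_y = (x == y)%:R.
Proof. exact: mcoeffU. Qed.

Lemma tensZU (K L : choiceType) (c : k) (x : K) (y : L) :
  tens (c *: << x >>) << y >> = c *: << (x, y) >>.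
Proof.
apply/malgP => -[x' y']; rewrite mcoeff_tens !mcoeffZ !mcoeff_basis xpair_eqE.
by rewrite -mulrA -natrM mulnb.
Qed.

Lemma tensUZ (K L : choiceType) (c : k) (x : K) (y : L) :
  tens << x >> (c *: << y >>) = c *: << (x, y) >>.
Proof.
apply/malgP => -[x' y']; rewrite mcoeff_tens !mcoeffZ !mcoeff_basis xpair_eqE.
by rewrite mulrCA -natrM mulnb.
Qed.

Lemma tensUU (K L : choiceType) (x : K) (y : L) :
  tens << x >> << y >> = << (x, y) >> :> {malg k[(K * L)%type]}.
Proof. by rewrite -[<< x >>]scale1r tensZU scale1r. Qed.

Lemma tens_map_sum (K L K' L' : choiceType)
    (f : {malg k[K]} -> {malg k[K']}) (g : {malg k[L]} -> {malg k[L']})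
    (T : finType) (P : pred T) (c : T -> k) (x : T -> K * L) :
  tens_map f g (\sum_(i | P i) c i *: << x i >>) =
    \sum_(i | P i) c i *: tens (f << (x i).1 >>) (g << (x i).2 >>).
Proof. exact: lin_ext_sum. Qed.

Lemma tau_sum (I : finType) (K L : choiceType)
    (T : finType) (P : pred T) (c : T -> k) (x : T -> {ffun I -> K * L}) :
  tau (\sum_(i | P i) c i *: << x i >>) =
    \sum_(i | P i) c i *: << ([ffun j => (x i j).1], [ffun j => (x i j).2]) >>.
Proof. exact: lin_ext_sum. Qed.

Lemma malgU_prod (M : conomType) (I : finType) (x : I -> M) :
  \prod_i << x i >> = << \big[mmul/mone]_i x i >> :> {malg k[M]}.
Proof.
elim/big_rec2: _ => [//|i y u _ ->]; by rewrite malgM_def fgmulUU mulr1.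
Qed.

Lemma pair_bigE (M N : conomType) (I : finType) (x : I -> M) (y : I -> N) :
  \big[mmul/mone]_i (x i, y i) =
    (\big[mmul/mone]_i x i, \big[mmul/mone]_i y i).
Proof. by elim/big_rec3: _ => [//|i a b u _ ->]. Qed.

(** Multilinearity of the pure tensor: each coefficient is a product of sums, to
    which distributivity applies. *)
Lemma big_tens_sum (V I : finType) (K : choiceType) (B : I -> {set V})
    (c : I -> {set V} -> k) (p : I -> {set V} -> K) :
  (forall i j x, x \in B i -> x \in B j -> i = j) ->
  big_tens (fun i => \sum_(S : {set V} | S \subset B i) c i S *: << p i S >>) =
    \sum_(S : {set V} | S \subset \bigcup_i B i)
       (\prod_i c i (S :&: B i)) *: << [ffun i => p i (S :&: B i)] >>.
Proof.
move=> Bdisj; apply/malgP => h; rewrite mcoeff_big_tens raddf_sum /=.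
transitivity (\prod_i \sum_(S : {set V} | S \subset B i)
                 c i S * (p i S == h i)%:R).
  apply: eq_bigr => i _; rewrite raddf_sum /=.
  by apply: eq_bigr => S _; rewrite mcoeffZ mcoeff_basis.
rewrite bigA_distr_subset //; apply: eq_bigr => S _.
rewrite mcoeffZ mcoeff_basis big_split /=; congr (_ * _).
have [<-|] := eqVneq; first by rewrite big1 // => i _; rewrite ffunE eqxx.
move=> pNh; have /existsP[i /negPf hi] : [exists i, p i (S :&: B i) != h i].
  rewrite -negb_forall; apply: contra pNh => /forallP e.
  by apply/eqP/ffunP => i; rewrite ffunE; apply/eqP.
by rewrite (bigD1 i) //= hi mul0r.
Qed.

End Algebra.

(** * Subforests inside a fixed forest *)

(** Sealed, so that two isomorphism classes are never compared by unfolding the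
    quotient, which is far too costly. *)
HB.lock Definition restr (n : nat) (V : finType) (t : cforest n V)
    (S : {set V}) : forest n := fclass (subforest t S).

Section Restriction.
Variables (n : nat) (V : finType) (t : cforest n V).
Implicit Types (S T B C : {set V}).

Let le_refl : reflexive (fle t). Proof. by case: (fle_forest t). Qed.
Let le_anti : antisymmetric (fle t). Proof. by case: (fle_forest t). Qed.
Let le_trans : transitive (fle t). Proof. by case: (fle_forest t). Qed.
Let le_chain : down_chains (fle t). Proof. by case: (fle_forest t). Qed.

(** The color of the edge of [t] leaving [x] towards [y].  In every subforest
    where [x] and [y] are joined by an edge, this is the color of that edge. *)
Definition first_color x y : option 'I_n :=
  [pick j | [exists w, fle t w y && (fcol t x w == Some j)]].

Lemma fcol_strict x w j : fcol t x w = Some j -> fle t x w /\ x != w.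
Proof.
move=> e; have : edge (fle t) x w by rewrite -fcol_edge e.
by case/andP=> /andP[-> ->].
Qed.

(** The vertices below [y] form a chain, so a path going down from [y] leaves [x]
    along only one edge. *)
Lemma edge_unique x w w' y : edge (fle t) x w -> edge (fle t) x w' ->
  fle t w y -> fle t w' y -> w = w'.
Proof.
have step u v : edge (fle t) x u -> edge (fle t) x v -> fle t u v -> u = v.
  move=> /andP[xu _] /andP[_ /forallP/(_ u)] + uv; rewrite xu /strict uv andbT.
  by move/negPn/eqP.
move=> e e' wy w'y; case/orP: (le_chain wy w'y) => h; first exact: step h.
by apply: esym; apply: step h.
Qed.

Lemma first_colorP x y j :
  reflect (exists2 w, fcol t x w = Some j & fle t w y)
          (first_color x y == Some j).
Proof.
apply: (iffP eqP) => [|[w xw wy]].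
  rewrite /first_color; case: pickP => // i /existsP[w /andP[wy /eqP e]] [<-].
  by exists w.
rewrite /first_color; case: pickP => [i /existsP[w' /andP[w'y /eqP xw']]|].
  rewrite -xw' -xw; congr (fcol t x _).
  by apply: (@edge_unique x) w'y wy; rewrite -fcol_edge ?xw ?xw'.
by move/(_ j)/existsP; case; exists w; rewrite wy xw eqxx.
Qed.

Lemma first_color_edge x y j : fcol t x y = Some j -> first_color x y = Some j.
Proof. by move=> e; apply/eqP/first_colorP; exists y. Qed.

Lemma first_color_strict x y j :
  first_color x y = Some j -> fle t x y /\ x != y.
Proof.
move=> /eqP/first_colorP[w /fcol_strict[xw xNw] wy].
split; first exact: le_trans wy.
by apply: contra xNw => /eqP e; apply/eqP/le_anti; rewrite xw e.
Qed.

Lemma first_color_le x y z j :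
  first_color x y = Some j -> fle t y z -> first_color x z = Some j.
Proof.
move=> /eqP/first_colorP[w xw wy] yz; apply/eqP/first_colorP.
by exists w => //; apply: le_trans yz.
Qed.

Lemma first_color_some x y : fle t x y -> x != y ->
  exists j, first_color x y = Some j.
Proof.
move=> xy xNy; have [|w] := @edge_below _ (fle t) x y le_refl le_anti le_trans.
  by rewrite /strict xNy.
rewrite -fcol_edge; case e: (fcol t x w) => [j|] // _ wy.
by exists j; apply/eqP/first_colorP; exists w.
Qed.

Lemma restrE S : restr t S = fclass (subforest t S).
Proof. by rewrite restr.unlock. Qed.

Lemma fsize_restr S : fsize (restr t S) = #|S|.
Proof.
by rewrite restrE fsize_class card_sig; apply: eq_card => x; rewrite !inE.
Qed.

Lemma fcol_subforest S (x y : {x | x \in S}) j :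
  fcol (subforest t S) x y = Some j -> first_color (val x) (val y) = Some j.
Proof. by rewrite fcol_mk /sub_col; case: ifP. Qed.

(** A forest is recognized as a subforest of [t] from the order and the colors of
    its edges alone: edges are determined by the order, and there is no color away
    from edges.  Injectivity of [g] follows from antisymmetry. *)
Lemma restr_eq (W : finType) (u : cforest n W) S (g : W -> V) :
  (forall w, g w \in S) -> (forall x, x \in S -> exists w, g w = x) ->
  {mono g : a b / fle u a b >-> fle t a b} ->
  (forall a b j, fcol u a b = Some j -> first_color (g a) (g b) = Some j) ->
  fclass u = restr t S.
Proof.
move=> gS gsurj gle gcol; rewrite restrE; apply/fclass_eq.
pose f w : {x | x \in S} := exist _ (g w) (gS w).
have [_ au _ _] := fle_forest u.
have fle_f : {mono f : a b / fle u a b >-> fle (subforest t S) a b}.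
  by move=> x y; rewrite fle_mk /sub_le gle.
have finj : injective f.
  by move=> x y e; apply: au; rewrite -!fle_f e fle_mk /sub_le le_refl.
have fbij : bijective f.
  have [h hP] : exists h : {x | x \in S} -> W, forall x, f (h x) = x.
    apply: (@fin_all_exists _ (fun=> W) (fun x w => f w = x)) => x.
    have [w e] := gsurj _ (valP x); exists w; exact/val_inj.
  by exists h => // w; apply: finj.
exists f; split=> // x y.
have := fcol_edge u x y; rewrite -(edge_bij fbij fle_f) -fcol_edge.
case e: (fcol u x y) => [j|]; case e': (fcol _ (f x) (f y)) => [i|] // _.
by have := fcol_subforest e'; rewrite /= (gcol _ _ _ e).
Qed.

Lemma restr_setT : fclass t = restr t setT.
Proof.
apply: (restr_eq (g := id)) => // [x _|]; first by exists x.
exact: first_color_edge.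
Qed.

Lemma restr_set0 : restr t set0 = mone.
Proof.
apply/esym/(restr_eq (g := fun v : void => match v with end)) => //; try by case.
by move=> x; rewrite inE.
Qed.

Lemma restrU S T :
  (forall x y, x \in S -> y \in T -> ~~ fle t x y && ~~ fle t y x) ->
  restr t (S :|: T) = mmul (restr t S) (restr t T).
Proof.
move=> sep; apply/esym; rewrite (restrE S) (restrE T) [LHS]fmul_class.
apply: (restr_eq (g := fun a => match a with inl x => val x | inr y => val y end)).
- by case=> x; rewrite inE (valP x) ?orbT.
- move=> x; rewrite inE; case/orP => xS.
    by exists (inl (exist _ x xS)).
  by exists (inr (exist _ x xS)).
- case=> x [] y; rewrite fle_mk /= ?fle_mk //.
    by have /andP[/negPf-> _] := sep _ _ (valP x) (valP y).
  by have /andP[_ /negPf->] := sep _ _ (valP y) (valP x).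
- by case=> x [] y j; rewrite fcol_mk //=; apply: fcol_subforest.
Qed.

Definition up_closed B := forall x y, x \in B -> fle t x y -> y \in B.

Section Family.
Variables (I : finType) (B : I -> {set V}).
Hypothesis Bup : forall i, up_closed (B i).
Hypothesis Bdisj : forall i j x, x \in B i -> x \in B j -> i = j.

Lemma family_separated i j x y :
  x \in B i -> y \in B j -> fle t x y -> i = j.
Proof. by move=> xi yj xy; apply: Bdisj (Bup xi xy) yj. Qed.

Lemma restr_family S : S \subset \bigcup_i B i ->
  restr t S = \big[mmul/mone]_i restr t (S :&: B i).
Proof.
move=> /setIidPl sub; rewrite -[in LHS]sub big_distrr /=.
elim: (index_enum I) (index_enum_uniq I) => [_|i r IH /= /andP[ir /IH e]].
  by rewrite !big_nil restr_set0.
rewrite !big_cons restrU ?e // => x y /setIP[_ xi].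
rewrite bigcup_seq => /bigcupP[j jr /setIP[_ yj]].
have iNj : i != j by apply: contraNneq ir => ->.
apply/andP; split; apply: contra iNj => h; apply/eqP.
  exact: family_separated h.
by apply/esym; apply: family_separated h.
Qed.

End Family.

(** When [r] is below all of [C], the subforest on [C] and [r] is a grafting whose
    [j]-th forest collects the vertices to which the path from [r] starts with an
    edge of color [j]. *)
Lemma restr_root r (C : {set V}) :
  (forall x, x \in C -> exists j, first_color r x = Some j) ->
  graft [ffun j => restr t (C :&: [set x | first_color r x == Some j])] =
    restr t (r |: C).
Proof.
move=> rC; set B := fun j : 'I_n => C :&: [set x | first_color r x == Some j].
set x := finfun _; have xE j : x j = restr t (B j) by rewrite ffunE.
have ex_f j : exists f : 'I_(fsize (x j)) -> {x | x \in B j},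
    [/\ bijective f,
        {mono f : a b / fle (frepr (x j)) a b >-> fle (subforest t (B j)) a b}
      & {mono f : a b / fcol (frepr (x j)) a b
                        >-> fcol (subforest t (B j)) a b}].
  by apply/fclass_eq; rewrite freprK xE restrE.
have [f fP] := fin_all_exists ex_f.
have fB j a : first_color r (val (f j a)) = Some j.
  by have := valP (f j a); rewrite !inE => /andP[_ /eqP].
pose g (a : option {j & 'I_(fsize (x j))}) :=
  if a is Some a' then val (f (tag a') (tagged a')) else r.
apply: (restr_eq (g := g)).
- case=> [[j a]|] /=; last by rewrite setU11.
  by have := valP (f j a); rewrite !inE => /andP[-> _]; rewrite orbT.
- move=> y /setU1P[->|yC]; first by exists None.
  have [j e] := rC y yC; have yB : y \in B j by rewrite !inE yC e eqxx.
  have [[h _ hK] _ _] := fP j.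
  exists (Some (Tagged (fun i => 'I_(fsize (x i))) (h (exist _ y yB)))).
  by rewrite /= hK.
- case=> [[i a]|] [[j b]|]; rewrite fle_mk //= ?fle_mk ?le_refl //.
  + case: (eqVneq i j) => [e|iNj].
      case: _ / e b => b; rewrite bigunion_leE; have [_ h _] := fP i.
      by rewrite -h fle_mk.
    rewrite /bigunion_le /= (negPf iNj); apply: contraNF iNj => h.
    by rewrite -(inj_eq Some_inj) -(fB j b) (first_color_le (fB i a) h).
  + have [rle rN] := first_color_strict (fB i a).
    by apply: contraNF rN => h; apply/eqP/le_anti; rewrite rle.
  + by have [->] := first_color_strict (fB j b).
- case=> [[i a]|] [[j b]|] c; rewrite fcol_mk //= ?fcol_mk.
  + rewrite /bigunion_col /=; case: eqP => // e.
    case: _ / e b => b; rewrite tagged_asE; have [_ _ h] := fP i.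
    by rewrite -h; apply: fcol_subforest.
  + by case: ifP => // _ [<-]; apply: fB.
Qed.

End Restriction.

(** * The coefficients *)

Section Weight.
Variables (n : nat) (V : finType) (t : cforest n V).
Implicit Types (S T B C : {set V}).

(** If [B] is up-closed and [C] is the complement of [s] in [B], this is the number
    [p_j(v, s, t|B)]: the edges of [t|B] are then the edges of [t] whose lower
    vertex is in [B]. *)
Definition edges_below j v C : nat :=
  #|[set e : V * V | [&& fcol t e.1 e.2 == Some j, fle t e.2 v & e.1 \in C]]|.

Lemma mem_edges_below j v C (e : V * V) :
  e \in [set e : V * V | [&& fcol t e.1 e.2 == Some j, fle t e.2 v & e.1 \in C]]
  -> [/\ fcol t e.1 e.2 = Some j, first_color t e.1 v = Some j & e.1 \in C].
Proof.
rewrite inE => /and3P[/eqP ej ev eC]; split=> //.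
exact: first_color_le (first_color_edge ej) ev.
Qed.

(** At most one edge with lower vertex [r] lies on the path down from [v], and its
    color is [first_color t r v]. *)
Lemma edges_belowU1 r j v C : r \notin C ->
  edges_below j v (r |: C) =
    (edges_below j v C + (first_color t r v == Some j))%N.
Proof.
move=> rNC; rewrite /edges_below.
set E := [set e | _]; set E' := [set e | _].
rewrite -(cardsID E' E); congr (_ + _)%N.
  apply: eq_card => e; rewrite !inE andbC.
  by apply: andb_idr => /and3P[-> -> ->]; rewrite orbT.
have -> : E :\: E' = [set e | [&& fcol t e.1 e.2 == Some j, fle t e.2 v
                                & e.1 == r]].
  apply/setP => e; rewrite !inE.
  have [->|_] := eqVneq e.1 r; first by rewrite (negPf rNC) !andbF /=.
  by rewrite /= !andbF andNb.
have [fc|nfc] := boolP (first_color t r v == Some j).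
  have /first_colorP[w rw wv] := fc.
  transitivity #|[set (r, w)]|; last by rewrite cards1.
  apply: eq_card => -[x y]; rewrite !inE xpair_eqE /=.
  apply/and3P/andP => [[/eqP xy yv /eqP e]|[/eqP-> /eqP->]]; last first.
    by rewrite rw !eqxx.
  rewrite e eqxx; split=> //; apply/eqP; rewrite e in xy.
  by apply: (@edge_unique _ _ t r) yv wv; rewrite -fcol_edge ?xy ?rw.
apply: eq_card0 => -[x y]; rewrite !inE /=.
apply: contraNF nfc => /and3P[/eqP xy yv /eqP e]; rewrite e in xy.
by apply/first_colorP; exists y.
Qed.

Variables (k : fieldType).
Implicit Type p : 'I_n -> k.

Definition weight p S C : k :=
  \prod_(j < n) p j ^+ (\sum_(v in S) edges_below j v C).

(** An edge on the path down from a vertex of [B i] has its lower vertex in [B i]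
    as soon as it is in the union: blocks contain no comparable vertices. *)
Lemma weight_family p (I : finType) (B : I -> {set V}) S C :
  (forall i, up_closed t (B i)) ->
  (forall i j x, x \in B i -> x \in B j -> i = j) ->
  S \subset \bigcup_i B i -> C \subset \bigcup_i B i ->
  weight p S C = \prod_i weight p (S :&: B i) (C :&: B i).
Proof.
move=> Bup Bdisj /setIidPl subS /subsetP subC.
rewrite exchange_big; apply: eq_bigr => j _ /=.
rewrite -expr_sum -[in LHS]subS big_distrr /= partition_disjoint_bigcup /=.
  congr (_ ^+ _); apply: eq_bigr => i _; apply: eq_bigr => v /setIP[_ vi].
  apply: eq_card => e; apply/idP/idP => [ein|]; last first.
    by rewrite !inE => /and3P[-> -> /andP[->]].
  have [_ /first_color_strict[ev _] eC] := mem_edges_below ein.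
  have /bigcupP[i' _ ei'] := subC _ eC.
  move: ein; rewrite !inE eC => /and3P[-> -> _] /=.
  by rewrite -(family_separated Bup Bdisj ei' vi ev).
move=> i i' iNi'; rewrite -setI_eq0; apply: contraNT iNi' => /set0Pn[x].
by rewrite !inE => /andP[/andP[_ xi] /andP[_ xi']]; apply/eqP/(Bdisj _ _ x).
Qed.

Lemma weight_rootr p r S C : r \notin C ->
  weight p S (r |: C) =
    (\prod_j p j ^+ #|S :&: [set x | first_color t r x == Some j]|)
      * weight p S C.
Proof.
move=> rNC; rewrite -big_split; apply: eq_bigr => j _ /=.
rewrite -exprD addnC -sum1_card; congr (_ ^+ _).
under eq_bigr do rewrite edges_belowU1 //.
rewrite big_split /=; congr (_ + _)%N.
rewrite (big_setID [set x | first_color t r x == Some j]) /=.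
rewrite [X in (_ + X)%N]big1 ?addn0.
  by apply: eq_bigr => x; rewrite !inE => /andP[_ ->].
by move=> x; rewrite !inE => /andP[/negPf->].
Qed.

Lemma weight_rootl p r S C : r \notin C ->
  {in S, forall x, ~~ fle t x r} -> weight p (r |: C) S = weight p C S.
Proof.
move=> rNC above; apply: eq_bigr => j _; congr (_ ^+ _).
rewrite big_setU1 //= [edges_below j r S]eq_card0 // => e.
apply/negP => /mem_edges_below[_ /first_color_strict[er _] eS].
by rewrite (negPf (above _ eS)) in er.
Qed.

Variable q : 'I_2 -> 'I_n -> k.

Definition split_coef S C : k := weight (q ord0) S C * weight (q ord_max) C S.

Lemma qcoefE S : qcoef q t S = split_coef S (~: S).
Proof.
by congr (_ * _); apply: eq_bigr => j _; congr (_ ^+ _); apply: eq_bigr => v _;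
  apply: eq_card => e; rewrite !inE ?negbK.
Qed.

Lemma split_coef_rootr r S C : r \notin C -> {in S, forall x, ~~ fle t x r} ->
  split_coef S (r |: C) = split_coef S C *
    \prod_j q ord0 j ^+ #|S :&: [set x | first_color t r x == Some j]|.
Proof.
move=> rNC above; rewrite /split_coef weight_rootr // weight_rootl //.
by rewrite -mulrA mulrC.
Qed.

Lemma split_coef_rootl r S C : r \notin S -> {in C, forall x, ~~ fle t x r} ->
  split_coef (r |: S) C = split_coef S C *
    \prod_j q ord_max j ^+ #|C :&: [set x | first_color t r x == Some j]|.
Proof.
move=> rNS above; rewrite /split_coef weight_rootr // weight_rootl //.
by rewrite [X in _ * X = _]mulrC mulrA.
Qed.

End Weight.

(** * The coproduct on up-closed sets *)

Section Coproduct.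
Variables (k : fieldType) (n : nat) (q : 'I_2 -> 'I_n -> k).
Variable Delta : {lrmorphism Calg k n -> Calg_tens2 k n}.

Lemma sigmaU i (x : 'I_n -> forest n) :
  sigma q i << [ffun j => x j] >> =
    (\prod_j q i j ^+ fsize (x j)) *: << \big[mmul/mone]_j x j >>.
Proof.
rewrite /sigma lin_extU malgU_prod.
by apply: (congr2 *:%R); last congr << _ >>; apply: eq_bigr => j _; rewrite ffunE.
Qed.

Lemma lambdaU (x : {ffun 'I_n -> forest n}) :
  lambda << x >> = << graft x >> :> Calg k n.
Proof. exact: lin_extU. Qed.

(** The defining equation of the coproduct, evaluated at a grafting of forests
    whose coproducts are known as sums over subsets. *)
Lemma coproduct_graft (V : finType) (B : 'I_n -> {set V})
    (c : 'I_n -> {set V} -> k) (f g : 'I_n -> {set V} -> forest n)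
    (x : {ffun 'I_n -> forest n}) :
  is_coproduct q Delta ->
  (forall i j v, v \in B i -> v \in B j -> i = j) ->
  (forall j, Delta << x j >> =
     \sum_(S : {set V} | S \subset B j) c j S *: << (f j S, g j S) >>) ->
  Delta << graft x >> =
    \sum_(S : {set V} | S \subset \bigcup_j B j)
      ((\prod_j c j (S :&: B j)) *
       \prod_j q ord0 j ^+ fsize (f j (S :&: B j))) *:
         << (\big[mmul/mone]_j f j (S :&: B j),
             graft [ffun j => g j (S :&: B j)]) >> +
    \sum_(S : {set V} | S \subset \bigcup_j B j)
      ((\prod_j c j (S :&: B j)) *
       \prod_j q ord_max j ^+ fsize (g j (S :&: B j))) *:
         << (graft [ffun j => f j (S :&: B j)],
             \big[mmul/mone]_j g j (S :&: B j)) >>.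
Proof.
move=> HDelta Bdisj Dx; have := HDelta << x >>; rewrite lambdaU => -> /=.
have -> : big_tens_map Delta << x >> =
    \sum_(S : {set V} | S \subset \bigcup_i B i)
       (\prod_i c i (S :&: B i)) *:
         << [ffun i => (f i (S :&: B i), g i (S :&: B i))] >>.
  rewrite /big_tens_map lin_extU.
  rewrite -(big_tens_sum c (fun i S => (f i S, g i S)) Bdisj).
  by apply/malgP => h; rewrite !mcoeff_big_tens; under eq_bigr do rewrite Dx.
have fst_pair (S : {set V}) :
    [ffun j => ([ffun i => (f i (S :&: B i), g i (S :&: B i))] j).1] =
    [ffun i => f i (S :&: B i)] by apply/ffunP => i; rewrite !ffunE.
have snd_pair (S : {set V}) :
    [ffun j => ([ffun i => (f i (S :&: B i), g i (S :&: B i))] j).2] =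
    [ffun i => g i (S :&: B i)] by apply/ffunP => i; rewrite !ffunE.
rewrite tau_sum; congr (_ + _); rewrite tens_map_sum;
  apply: eq_bigr => S _; rewrite fst_pair snd_pair sigmaU lambdaU.
  by rewrite tensZU scalerA.
by rewrite tensUZ scalerA.
Qed.

Hypothesis HDelta : is_coproduct q Delta.
Variables (V : finType) (t : cforest n V).

Definition splits_coproduct (B : {set V}) : Prop :=
  Delta << restr t B >> =
    \sum_(S : {set V} | S \subset B)
      split_coef t q S (B :\: S) *: << (restr t S, restr t (B :\: S)) >>.

Section Family.
Variables (I : finType) (B : I -> {set V}).
Hypothesis Bup : forall i, up_closed t (B i).
Hypothesis Bdisj : forall i j x, x \in B i -> x \in B j -> i = j.

Lemma split_coef_family (S : {set V}) : S \subset \bigcup_i B i ->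
  \prod_i split_coef t q (S :&: B i) (B i :\: (S :&: B i)) =
    split_coef t q S (\bigcup_i B i :\: S).
Proof.
move=> sub; rewrite /split_coef !(@weight_family _ _ _ _ _ _ B) ?subsetDl //.
by rewrite -big_split; apply: eq_bigr => i _; rewrite setD_family.
Qed.

Lemma restr_compl_family (S : {set V}) :
  \big[mmul/mone]_i restr t (B i :\: (S :&: B i)) =
    restr t (\bigcup_i B i :\: S).
Proof.
rewrite (restr_family Bup Bdisj) ?subsetDl //.
by apply: eq_bigr => i _; rewrite setD_family.
Qed.

Lemma splits_coproduct_union :
  (forall i, splits_coproduct (B i)) -> splits_coproduct (\bigcup_i B i).
Proof.
move=> split; rewrite /splits_coproduct (restr_family Bup Bdisj) //.
rewrite -malgU_prod rmorph_prod.
have capB i : \bigcup_i B i :&: B i = B i by apply/setIidPr/bigcup_sup.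
have splitB i : Delta << restr t (\bigcup_i B i :&: B i) >> = _ :=
  etrans (congr1 (fun C => Delta << restr t C >>) (capB i)) (split i).
rewrite (eq_bigr _ (fun i _ => splitB i)).
rewrite bigA_distr_subset //; apply: eq_bigr => S sub.
rewrite scaler_prod malgU_prod pair_bigE restr_compl_family.
rewrite -(restr_family Bup Bdisj sub).
by rewrite -split_coef_family.
Qed.

End Family.

Lemma splits_coproduct_root (r : V) (B : {set V}) :
  (forall x, x \in B = fle t r x) ->
  (forall j, splits_coproduct [set x | first_color t r x == Some j]) ->
  splits_coproduct B.
Proof.
move=> BE split; have [le_refl le_anti le_trans _] := fle_forest t.
pose T j := [set x | first_color t r x == Some j].
have Tup j : up_closed t (T j).
  by move=> x y; rewrite !inE => /eqP rx xy; rewrite (first_color_le rx xy).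
have Tdisj i j x : x \in T i -> x \in T j -> i = j.
  by rewrite !inE => /eqP-> /eqP[].
pose U := \bigcup_j T j.
have inU x : x \in U -> exists j, first_color t r x = Some j.
  by case/bigcupP=> j _; rewrite inE => /eqP; exists j.
have above x : x \in U -> ~~ fle t x r.
  case/inU=> j /first_color_strict[rx rNx].
  by apply: contra rNx => xr; apply/eqP/le_anti; rewrite rx.
have rNU : r \notin U by apply/negP => /above; rewrite le_refl.
have BU : B = r |: U.
  apply/setP => x; rewrite BE !inE; have [->|xNr] := eqVneq x r.
    by rewrite le_refl.
  apply/idP/bigcupP => [rx|[j _]].
    have [|j e] := first_color_some rx; first by rewrite eq_sym.
    by exists j; rewrite ?inE ?e.
  by rewrite inE => /eqP/first_color_strict[].
have graftU (C : {set V}) : C \subset U ->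
    graft [ffun j => restr t (C :&: T j)] = restr t (r |: C).
  by move=> /subsetP CU; apply: restr_root => x /CU/inU.
rewrite BU /splits_coproduct -graftU //.
rewrite (coproduct_graft HDelta Tdisj
           (c := fun j S => split_coef t q S (T j :\: S))
           (f := fun j S => restr t S)
           (g := fun j S => restr t (T j :\: S))); last first.
  move=> j; rewrite ffunE; have -> : U :&: T j = T j by apply/setIidPr/bigcup_sup.
  exact: split.
(* sigma_1 accounts for the subsets omitting r, sigma_2 for the others *)
rewrite -/U [RHS](bigID (fun S : {set V} => r \notin S)) /=.
apply: (congr2 +%R).
  apply: eq_big => [S|S SU].
    apply/idP/andP => [SU|[SrU rNS]].
      split; first exact: subset_trans SU (subsetUr _ _).
      by apply: contra rNU; apply: (subsetP SU).
    apply/subsetP => x xS; have := subsetP SrU _ xS.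
    by rewrite !inE; case: eqP => [e|//]; rewrite e (negPf rNS) in xS.
  have rNS : r \notin S by apply: contra rNU; apply: (subsetP SU).
  have -> : (r |: U) :\: S = r |: (U :\: S).
    by rewrite setDUl (setDidPl _) // disjoints1.
  apply: (congr2 *:%R).
    rewrite [RHS]split_coef_rootr ?inE ?(negPf rNU) ?andbF //; last first.
      by move=> x /(subsetP SU); apply: above.
    apply: (congr2 *%R); first exact: split_coef_family.
    by apply: eq_bigr => j _; rewrite fsize_restr.
  apply: (congr1 (fun x => << x >>)); apply: (congr2 pair).
    exact/esym/restr_family.
  rewrite -graftU ?subsetDl //; congr graft.
  by apply/ffunP => j; rewrite !ffunE (setD_family T).
(* the subsets containing r are the r |: S with S included in U *)
rewrite [RHS](reindex_onto (fun S => r |: S) (fun S => S :\ r)) /=; last first.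
  by move=> S /andP[_ /negPn rS]; rewrite setD1K.
apply: eq_big => [S|S SU].
  rewrite setU11 andbT; apply/idP/andP => [SU|[rSU]].
    split; first exact: setUS.
    by rewrite setU1K //; apply: contra rNU; apply: (subsetP SU).
  move=> /eqP e; have rNS : r \notin S by rewrite -e !inE eqxx.
  apply/subsetP => x xS; have := subsetP rSU x.
  by rewrite !inE xS orbT => /(_ isT)/orP[/eqP xr|//]; rewrite -xr xS in rNS.
have rNS : r \notin S by apply: contra rNU; apply: (subsetP SU).
have -> : (r |: U) :\: (r |: S) = U :\: S.
  apply/setP => x; rewrite !inE negb_or.
  have [->|] //= := eqVneq x r; by rewrite (negPf rNU) andbF.
apply: (congr2 *:%R).
  rewrite [RHS]split_coef_rootl //; last by move=> x /setDP[/above].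
  apply: (congr2 *%R); first exact: split_coef_family.
  by apply: eq_bigr => j _; rewrite fsize_restr (setD_family T).
apply: (congr1 (fun x => << x >>)); apply: (congr2 pair).
  exact: graftU.
exact: restr_compl_family.
Qed.

Lemma splits_coproduct_up_closed (B : {set V}) :
  up_closed t B -> splits_coproduct B.
Proof.
have [le_refl le_anti le_trans chain] := fle_forest t.
have [m] := ubnP #|B|; elim: m B => // m IH B leBm Bup.
have [->|[x0 x0B]] := set_0Vmem B.
  rewrite /splits_coproduct (big_pred1 set0) => [|S]; last by rewrite subset0.
  rewrite set0D restr_set0 /split_coef /weight !big1 ?mulr1 ?scale1r ?rmorph1 //.
    by move=> j _; rewrite big_set0.
  by move=> j _; rewrite big_set0.
(* a vertex with fewest vertices below it is minimal in B *)
have [r rB rmin] :=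
  @arg_minnP V x0 (fun x => x \in B) (fun x => #|[set y | fle t y x]|) x0B.
have r_minimal x : x \in B -> fle t x r -> x = r.
  move=> xB xr; apply: le_anti; rewrite xr /=.
  have sub : [set y | fle t y x] \subset [set y | fle t y r].
    by apply/subsetP => y; rewrite !inE => /le_trans; apply.
  have /eqP e : [set y | fle t y x] == [set y | fle t y r].
    by rewrite eqEcard sub rmin.
  by move/setP/(_ r): e; rewrite !inE le_refl.
pose A := [set x | fle t r x].
have AB : A \subset B by apply/subsetP => x; rewrite inE; apply: Bup.
have [BA|BNA] := eqVneq B A.
  apply: (@splits_coproduct_root r) => [x|j]; first by rewrite BA inE.
  apply: IH => [|x y]; last first.
    by rewrite !inE => /eqP rx xy; rewrite (first_color_le rx xy).
  rewrite ltnS in leBm; apply: leq_trans leBm; apply/proper_card/properP.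
  split; first by apply/subsetP => x; rewrite BA !inE => /eqP/first_color_strict[].
  exists r => //; rewrite inE.
  by apply/eqP => /first_color_strict[_]; rewrite eqxx.
(* B has another minimal vertex: split off the tree rooted at r *)
pose P (b : bool) := if b then A else B :\: A.
have Pup b : up_closed t (P b).
  case: b => x y; rewrite /P !inE; first by move=> rx; apply: le_trans rx.
  case/andP=> rNx xB xy; rewrite (Bup x) // andbT.
  apply: contra rNx => ry; case/orP: (chain _ _ _ xy ry) => // xr.
  by rewrite (r_minimal _ xB xr).
have Pdisj b b' x : x \in P b -> x \in P b' -> b = b'.
  by case: b; case: b' => //; rewrite /P !inE; [move=> ->|move=> /andP[/negPf->]].
have -> : B = \bigcup_b P b.
  rewrite big_bool /= setUC setDE setUIl [~: A :|: A]setUC setUCr setIT.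
  by apply/esym/setUidPl.
apply: splits_coproduct_union => // b; apply: IH => //; move: leBm; rewrite ltnS.
apply: leq_trans; apply: proper_card; case: b => /=.
  by rewrite properEneq eq_sym BNA.
by apply/properP; split; [apply: subsetDl|exists r; rewrite // !inE le_refl].
Qed.

End Coproduct.

Theorem theorem6p3 (k : fieldType) (n : nat) (q : 'I_2 -> 'I_n -> k)
    (Delta : {lrmorphism Calg k n -> Calg_tens2 k n})
    (HDelta : is_coproduct q Delta)
    (V : finType) (t : cforest n V) :
  Delta << fclass t >> =
    \sum_(S : {set V})
      qcoef q t S *:
        tens << fclass (subforest t S) >> << fclass (subforest t (~: S)) >>.
Proof.
rewrite restr_setT (splits_coproduct_up_closed HDelta) => [|x y]; last first.
  by rewrite !inE.
apply: eq_big => [S|S _]; first by rewrite subsetT.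
by rewrite tensUU -!restrE setTD qcoefE.
Qed.
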